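(* Being an open mapping is not preserved under the relation of $L$-equivalence, even within the class of perfect retractions. That is, there exist perfect retractions $f: X\to Y$ and $g: Z\to T$ of topological spaces that are $L$-equivalent and such that $f$ is open while $g$ is not open.
   Context: All topological spaces are Tychonoff; all locally convex spaces are real and Hausdorff. A retraction is a continuous mapping $r: X\to K$ onto a subspace $K\subset X$ with $r(x)=x$ for all $x\in K$. A perfect mapping is a continuous closed mapping with compact fibers. The free locally convex space $L(X)$ over $X$ is a locally convex space with a continuous injection $\delta_X: X\to L(X)$ such that $L(X)$ is the linear span of $\delta_X(X)$ and every continuous $f: X\to E$ to a locally convex space $E$ satisfies $f=f_\#\circ\delta_X$ for a (unique) continuous linear $f_\#: L(X)\to E$. It exists and is unique up to topological isomorphism, $\delta_X$ is a closed topological embedding, and $X$ is identified with $\delta_X(X)$. For continuous $f: X\to Y$, $f_\#: L(X)\to L(Y)$ denotes the continuous linear extension of $f$. Continuous mappings $f: X\to Y$ and $g: Z\to T$ are $L$-equivalent if there are topological isomorphisms (linear homeomorphisms) $\varphi: L(X)\to L(Z)$ and $\psi: L(Y)\to L(T)$ with $\psi\circ f_\#=g_\#\circ\varphi$. *)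

(* Defs.v *)
From mathcomp Require Import all_boot all_order all_algebra.
From mathcomp Require Import all_classical all_reals all_analysis.

Set Implicit Arguments.
Unset Strict Implicit.
Unset Printing Implicit Defensive.

Import GRing.Theory numFieldNormedType.Exports.
Local Open Scope classical_set_scope.
Local Open Scope ring_scope.

Definition tychonoff_space (X : topologicalType) : Prop :=
  hausdorff_space X /\ completely_regular_space X.

Definition open_mapping (X Y : topologicalType) (f : X -> Y) : Prop :=
  forall U : set X, open U -> open (f @` U).

Definition perfect_mapping (X Y : topologicalType) (f : X -> Y) : Prop :=
  [/\ continuous f,
      forall C : set X, closed C -> closed (f @` C) &
      forall y : Y, compact (f @^-1` [set y])].

(* The codomain is the subspace K itself: a set used as a type carries the
   topology induced by its inclusion set_val into X. *)
Definition retraction (X : topologicalType) (K : set X) (r : X -> K) : Prop :=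
  continuous r /\ forall x : K, r (set_val x) = x.

(* tvsType bundles local convexity but not the Hausdorff axiom. *)
Definition lcs (R : realType) (E : tvsType R) : Prop := hausdorff_space E.

(* (L, delta) is the free locally convex space over X; the linear extension
   is unique because delta spans L. *)
Definition is_free_lcs (R : realType) (X : topologicalType) (L : tvsType R)
    (delta : X -> L) : Prop :=
  [/\ lcs L,
      continuous delta,
      injective delta,
      (forall v : L, exists s : seq (R * X),
         v = \sum_(p <- s) p.1 *: delta p.2) &
      forall (E : tvsType R) (f : X -> E), lcs E -> continuous f ->
        exists h : {linear L -> E}, continuous h /\ f = h \o delta].

(* h is the map f_# : L(X) -> L(Y) extending f : X -> Y. *)
Definition is_sharp (R : realType) (X Y : topologicalType) (LX LY : tvsType R)
    (dX : X -> LX) (dY : Y -> LY) (f : X -> Y) (h : {linear LX -> LY}) : Prop :=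
  continuous h /\ h \o dX = dY \o f.

Definition topological_iso (R : realType) (E F : tvsType R)
    (phi : {linear E -> F}) : Prop :=
  continuous phi /\
  exists phi' : F -> E,
    [/\ continuous phi', cancel phi phi' & cancel phi' phi].

(* As L(X) is determined up to topological isomorphism, the choice of the four
   free spaces is immaterial. *)
Definition L_equivalent (R : realType) (X Y Z T : topologicalType)
    (f : X -> Y) (g : Z -> T) : Prop :=
  [/\ continuous f, continuous g &
  exists (LX LY LZ LT : tvsType R)
    (dX : X -> LX) (dY : Y -> LY) (dZ : Z -> LZ) (dT : T -> LT),
    [/\ is_free_lcs dX, is_free_lcs dY, is_free_lcs dZ, is_free_lcs dT &
     exists (fs : {linear LX -> LY}) (gs : {linear LZ -> LT})
       (phi : {linear LX -> LZ}) (psi : {linear LY -> LT}),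
       [/\ is_sharp dX dY f fs, is_sharp dZ dT g gs,
           topological_iso phi, topological_iso psi &
           psi \o fs = gs \o phi]]].

(* Main.v *)
Require Import Defs.
From HB Require Import structures.
From mathcomp Require Import all_boot all_order all_algebra.
From mathcomp Require Import freeg.
From mathcomp Require Import all_classical all_reals all_analysis.
From mathcomp Require Import lra.

(** Any two retractions [f] and [g] of a Tychonoff space [X] onto the same
    subspace [K] are [L]-equivalent.  Indeed the linear endomorphism [phi] of
    [L(X)] with [phi x = x + f x - g x] on generators is inverse to the one
    with [x |-> x - f x + g x], because [f] and [g] fix [K] pointwise, and
    [g_# (phi x) = g x + f x - g x = f x]; so [g_# \o phi = f_#], with the
    identity on [L(K)] ([retraction_L_equivalent]).  In other words, the
    idempotent endomorphisms [F] and [G] of [L(X)] induced by [f] and [g]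
    satisfy [F G = G] and [G F = F], so [(F - G)^2 = 0] and [1 + (F - G)] is
    inverse to [1 - (F - G)].

    Openness does not survive this exchange.  Take two copies of a compact
    space [Y] without isolated points, here the Cantor space, and retract
    them onto the first copy: superposing the two copies is an open map, while
    sending the whole second copy to one point [y0] is not, since the second
    copy is open and [y0] is not isolated.  Both maps are perfect, being
    continuous from a compact space to a Hausdorff one.

    The remaining work is the existence of [L(X)].  Algebraically it is the
    space of finitely supported formal combinations of points of [X].  Its
    topology is generated at [0] by all absorbing absolutely convex sets [W]
    such that [y |-> y - x] is continuous at [x] for the gauge of [W], for
    every point [x].  This is the finest locally convex topology that makes
    the generators depend continuously on the point, whence the universal
    property; it is Hausdorff because extending real continuous functions
    linearly separates the points of [L(X)] when such functions separate the
    points of [X]. *)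

Set Implicit Arguments.
Unset Strict Implicit.
Unset Printing Implicit Defensive.

Import Order.TTheory GRing.Theory Num.Theory numFieldNormedType.Exports.
Local Open Scope classical_set_scope.
Local Open Scope ring_scope.

(** * Absolutely convex sets *)

(** A single inequality packs convexity and symmetry together, which is the
    form that the estimates for addition and scaling consume. *)
Definition disk (R : realType) (E : lmodType R) (W : set E) :=
  forall (a b : R) v w, `|a| + `|b| <= 1 -> W v -> W w -> W (a *: v + b *: w).

Lemma disk0 (R : realType) (E : lmodType R) (W : set E) v : disk W -> W v -> W 0.
Proof.
move=> dW Wv; have := dW 0 0 v v.
by rewrite !scale0r addr0 normr0 addr0 => /(_ ler01); exact.
Qed.

Lemma disk_scale (R : realType) (E : lmodType R) (W : set E) a v :
  disk W -> `|a| <= 1 -> W v -> W (a *: v).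
Proof.
move=> dW a1 Wv; have := dW a 0 v v.
by rewrite scale0r !addr0 normr0 addr0; exact.
Qed.

Lemma disk_half (R : realType) (E : lmodType R) (W : set E) v w :
  disk W -> W (2 *: v) -> W (2 *: w) -> W (v + w).
Proof.
move=> dW Wv Ww; have := dW 2^-1 2^-1 _ _ _ Wv Ww.
rewrite !scalerA mulVf// !scale1r; apply.
by rewrite ger0_norm ?invr_ge0//; lra.
Qed.

(** A basic convex neighborhood [V] yields the disk [V `&` - V].  Passing from
    convexity and symmetry to the absolutely convex form replaces [a *: v] by
    [`|a| *: v'] with [v' = v] or [v' = - v], then uses the convex combination
    of weights [`|a| / s] and [`|b| / s], shrunk towards [0] by the factor
    [s = `|a| + `|b|]. *)
Lemma tvs_disk (R : realType) (E : tvsType R) (U : set E) :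
  nbhs 0 U -> exists W, [/\ disk W, W `<=` U & nbhs 0 W].
Proof.
move=> U0; have [B Bconv [Bopen Bbase]] := @locally_convex R E.
have [V [BV V0] VU] := Bbase 0 U U0.
have Vconv (t : R) v w : 0 <= t -> t <= 1 -> V v -> V w ->
    V (t *: v + (1 - t) *: w).
  move=> t0 t1 /mem_set Vv /mem_set Vw.
  have := Bconv V (mem_set BV) v w (Itv01 t0 t1) Vv Vw.
  by rewrite inE.
pose W := [set v | V v /\ V (- v)].
have nV : nbhs 0 V by apply: open_nbhs_nbhs; split => //; exact: Bopen.
exists W; split; last 2 first.
- by move=> v [/VU].
- apply: filterI => //.
  have := nbhs0N nV; apply: filterS => _ [v Vv <-].
  by rewrite opprK.
have W0 : W 0 by split; rewrite ?oppr0.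
have Wconv (t : R) v w : 0 <= t -> t <= 1 -> W v -> W w ->
    W (t *: v + (1 - t) *: w).
  move=> t0 t1 [v1 v2] [w1 w2]; split; first exact: Vconv.
  by rewrite opprD -!scalerN; exact: Vconv.
have Wabs a v : W v -> exists2 v', W v' & a *: v = `|a| *: v'.
  move=> Wv; have [a0|a0] := leP 0 a.
    by exists v; rewrite ?ger0_norm.
  exists (- v); last by rewrite ltr0_norm// scaleNr scalerN opprK.
  by case: Wv => ? ?; split; rewrite ?opprK.
move=> a b v w ab /(Wabs a)[v' Wv ->] /(Wabs b)[w' Ww ->].
have [s0|s0] := eqVneq (`|a| + `|b|) 0.
  have -> : `|a| = 0 by have := normr_ge0 a; have := normr_ge0 b; lra.
  have -> : `|b| = 0 by have := normr_ge0 a; have := normr_ge0 b; lra.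
  by rewrite !scale0r addr0.
have sp : 0 < `|a| + `|b| by rewrite lt0r s0 addr_ge0.
set s := `|a| + `|b| in ab s0 sp.
have := Wconv s (`|a| / s *: v' + (1 - `|a| / s) *: w') 0 (ltW sp) ab _ W0.
have -> : 1 - `|a| / s = `|b| / s.
  by rewrite -[1](divff s0) -mulrBl /s addrAC subrr add0r.
rewrite scaler0 addr0 scalerDr !scalerA !(mulrC s) !divfK//; apply.
have -> : `|b| / s = 1 - `|a| / s.
  by rewrite -[1](divff s0) -mulrBl /s addrAC subrr add0r.
apply: Wconv => //; first by rewrite divr_ge0// ltW.
by rewrite ler_pdivrMr// mul1r /s lerDl.
Qed.

(** * The free locally convex space *)

Section free_space.
Context (R : realType) (X : topologicalType).

Definition free_lmod := {freeg X / R}.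

HB.instance Definition _ := GRing.Lmodule.on free_lmod.
HB.instance Definition _ := Choice.on free_lmod.

Definition free_gen (x : X) : free_lmod := << x >>.

Section lift.
Context (E : lmodType R) (f : X -> E).

Definition free_lift (v : free_lmod) : E := fglift f v.

Lemma free_lift_gen x : free_lift (free_gen x) = f x.
Proof. by rewrite /free_lift liftU scale1r. Qed.

(** Homogeneity follows from additivity by expanding a vector over its
    support. *)
Fact free_lift_linear : linear free_lift.
Proof.
have fB : {morph free_lift : v w / v - w} := lift_is_additive f.
pose fA := GRing.isZmodMorphism.Build free_lmod E free_lift fB.
pose fAd : {additive free_lmod -> E} := HB.pack free_lift fA.
have fU (a : R) x : fAd << a *g x >> = a *: f x by exact: liftU.
move=> a v w; have -> : free_lift (a *: v + w) = free_lift (a *: v) + free_lift w.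
  exact: (raddfD fAd).
congr (_ + _).
transitivity (fAd (fgscale a v)) => //.
rewrite raddf_sum -[in RHS](freeg_sumE v).
have -> : free_lift (\sum_(z <- dom v) << coeff z v *g z >>)
    = fAd (\sum_(z <- dom v) << coeff z v *g z >>) by [].
rewrite raddf_sum scaler_sumr.
by apply: eq_bigr => x _; rewrite !fU scalerA.
Qed.

HB.instance Definition _ :=
  GRing.isLinear.Build R free_lmod E *:%R free_lift free_lift_linear.

End lift.

Lemma free_genE (v : free_lmod) :
  v = \sum_(x <- dom v) coeff x v *: free_gen x.
Proof.
rewrite -{1}[v]freeg_sumE; apply: eq_bigr => x _.
by apply/eqP/freeg_eqP => y; rewrite coeffZ !coeffU mul1r.
Qed.

(** These sets generate the topology at [0].  The last condition, with its
    arbitrary factor [e], says that the gauge of [W] tends to [0] on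
    [free_gen y - free_gen x] as [y] tends to [x]; with the factor, the family
    of these sets is stable under rescaling. *)
Definition free_disk (W : set free_lmod) :=
  [/\ disk W, forall v, exists2 e : R, 0 < e & W (e *: v) &
      forall (e : R) (x : X),
        \forall y \near x, W (e *: (free_gen y - free_gen x))].

Lemma free_diskT : free_disk setT.
Proof.
split=> // [v|e x]; first by exists 1.
exact: filterT.
Qed.

Lemma free_disk0 W : free_disk W -> W 0.
Proof. by case=> dW aW _; have [e _ /(disk0 dW)] := aW 0. Qed.

Lemma free_diskI W W' : free_disk W -> free_disk W' -> free_disk (W `&` W').
Proof.
move=> [dW aW gW] [dW' aW' gW']; split.
- by move=> a b v w ab [? ?] [? ?]; split; [exact: dW|exact: dW'].
- move=> v; have [e e0 We] := aW v; have [e' e'0 We'] := aW' v.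
  (* the smaller of the two absorption factors works for both disks *)
  have min_scale (d : R) : 0 < d -> Num.min e e' <= d ->
      exists2 a : R, `|a| <= 1 & Num.min e e' *: v = a *: (d *: v).
    move=> d0 ed; exists (Num.min e e' / d); last by rewrite scalerA divfK ?gt_eqF.
    rewrite ger0_norm ?ler_pdivrMr ?mul1r//.
    by rewrite divr_ge0 ?le_min ?(ltW e0) ?ltW.
  exists (Num.min e e'); first by rewrite lt_min e0.
  split.
  + have [|a a1 ->] := min_scale e e0; first by rewrite ge_min lexx.
    exact: disk_scale.
  + have [|a a1 ->] := min_scale e' e'0; first by rewrite ge_min lexx orbT.
    exact: disk_scale.
- by move=> e x; apply: filterI; [exact: gW|exact: gW'].
Qed.

Lemma free_diskZ W (c : R) : free_disk W -> free_disk [set v | W (c *: v)].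
Proof.
move=> [dW aW gW]; split.
- move=> a b v w ab /= Wv Ww.
  by rewrite scalerDr !scalerA !(mulrC c) -!scalerA; exact: dW.
- move=> v; have [e e0 We] := aW (c *: v).
  by exists e => //=; rewrite scalerA mulrC -scalerA.
- move=> e x; have := gW (c * e) x; apply: filterS => y.
  by rewrite /= scalerA.
Qed.

Definition free_nbhs (v : free_lmod) (A : set free_lmod) :=
  exists2 W, free_disk W & forall w, W w -> A (v + w).

HB.instance Definition _ := hasNbhs.Build free_lmod free_nbhs.

Fact free_nbhs_filter (v : free_lmod) : ProperFilter (nbhs v).
Proof.
apply: Build_ProperFilter_ex.
  by move=> A [W /free_disk0 W0 WA]; exists (v + 0); exact: WA.
split.
- by exists setT => //; exact: free_diskT.
- move=> A B [W dW WA] [W' dW' WB].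
  exists (W `&` W'); first exact: free_diskI.
  by move=> w [? ?]; split; [exact: WA|exact: WB].
- by move=> A B AB [W dW WA]; exists W => // w /WA /AB.
Qed.

Fact free_nbhs_singleton (v : free_lmod) (A : set free_lmod) : nbhs v A -> A v.
Proof. by move=> [W /free_disk0 W0 /(_ _ W0)]; rewrite addr0. Qed.

(** If [v + W] lies in [A], then [A] is a neighborhood of every point of
    [v + W / 2]. *)
Fact free_nbhs_nbhs (v : free_lmod) (A : set free_lmod) :
  nbhs v A -> nbhs v (nbhs^~ A).
Proof.
move=> [W dW WA]; exists [set w | W (2 *: w)]; first exact: free_diskZ.
move=> w Ww; exists [set w | W (2 *: w)]; first exact: free_diskZ.
move=> u Wu; rewrite -addrA; apply: WA; apply: disk_half => //.
by case: dW.
Qed.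

HB.instance Definition _ := Nbhs_isNbhsTopological.Build free_lmod
  free_nbhs_filter free_nbhs_singleton free_nbhs_nbhs.

Fact free_add_continuous :
  continuous (fun vw : free_lmod * free_lmod => vw.1 + vw.2).
Proof.
move=> [v w] A [W dW WA] /=.
have hW : free_disk [set w | W (2 *: w)] by exact: free_diskZ.
exists ([set v + u | u in [set u | W (2 *: u)]],
        [set w + u | u in [set u | W (2 *: u)]]).
  by split; exists [set w | W (2 *: w)] => // u Wu; exists u.
move=> [_ _] [/= [u Wu <-] [u' Wu' <-]]; rewrite addrACA; apply: WA.
by apply: disk_half => //; case: dW.
Qed.

Fact free_scale_continuous :
  continuous (fun av : R^o * free_lmod => av.1 *: av.2).
Proof.
move=> [a v] A [W dW WA] /=.
have [dkW aW _] := dW; have [e e0 We] := aW v.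
pose M := 2 * (`|a| + 1).
have M0 : 0 < M by rewrite mulr_gt0// ltr_wpDl.
exists (ball a (Num.min (e / 2) 1), [set v + u | u in [set u | W (M *: u)]]).
  split; first by apply: nbhsx_ballx; rewrite lt_min divr_gt0//=.
  by exists [set u | W (M *: u)] => [|u Wu]; [exact: free_diskZ|exists u].
move=> [b _] [/= ab [u Wu <-]].
have [ab1 ab2] : `|b - a| <= e / 2 /\ `|b - a| <= 1.
  move: ab; rewrite /ball /= distrC lt_min => /andP[/ltW ? /ltW].
  by split.
(* the error [b (v + u) - a v] is a combination of vectors of [W] with two
   coefficients of absolute value at most 1/2 *)
have -> : b *: (v + u) = a *: v + (((b - a) / e) *: (e *: v)
                                   + (b / M) *: (M *: u)).
  rewrite !scalerA !divfK ?gt_eqF// scalerBl addrA addrCA subrr addr0.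
  by rewrite scalerDr.
apply: WA; apply: dkW => //.
have bE : `|b / M| <= 2^-1.
  rewrite normrM normfV (gtr0_norm M0) ler_pdivrMr// /M mulKf//.
  by have := ler_normD (b - a) a; rewrite subrK; lra.
have bE' : `|(b - a) / e| <= 2^-1.
  by rewrite normrM normfV (gtr0_norm e0) ler_pdivrMr// mulrC.
by lra.
Qed.

(** The open convex sets form a base: for a disk [W], the interior of [v + W]
    is convex, since if [x + U] and [y + V] lie in [v + W], then so does the
    translate of [U `&` V] by any convex combination of [x] and [y]. *)
Fact free_locally_convex : exists2 B : set_system free_lmod,
  (forall U, U \in B -> convex_set U) & basis B.
Proof.
exists [set U | open U /\ convex_set U]; first by move=> U /[!inE] -[].
split; first by move=> U [].
move=> v A [W dW WA]; have [dkW _ _] := dW.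
exists (interior [set v + w | w in W]); last first.
  by move=> u /interior_subset[w /WA + <-].
split; last by exists W => // w Ww; exists w.
split; first exact: open_interior.
move=> x y t /set_mem[U dU Ux] /set_mem[V dV Vy]; apply/mem_set.
exists (U `&` V); first exact: free_diskI.
move=> z [/Ux[x' Wx' xE] /Vy[y' Wy' yE]].
exists (t%:num *: x' + (1 - t%:num) *: y').
  apply: dkW => //.
  by rewrite !ger0_norm ?subr_ge0// addrC subrK.
rewrite [X in X + z](_ : _ = t%:num *: x + (1 - t%:num) *: y)//.
have zE : z = t%:num *: z + (1 - t%:num) *: z.
  by rewrite -scalerDl addrC subrK scale1r.
have vE : v = t%:num *: v + (1 - t%:num) *: v.
  by rewrite -scalerDl addrC subrK scale1r.
by rewrite [in RHS]zE [in LHS]vE addrACA [in RHS]addrACA -!scalerDr xE yE.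
Qed.

(* This instance derives only the uniform structure from the neighborhoods of
   [0]; the three after it add the axioms of a locally convex space. *)
HB.instance Definition _ := PreTopologicalLmod_isTvs.Build R free_lmod
  free_add_continuous free_scale_continuous free_locally_convex.

HB.instance Definition _ :=
  PreTopologicalNmodule_isTopologicalNmodule.Build free_lmod
    free_add_continuous.
HB.instance Definition _ :=
  TopologicalNmodule_isTopologicalLmodule.Build R free_lmod
    free_scale_continuous.
HB.instance Definition _ :=
  Uniform_isTvs.Build R free_lmod free_locally_convex.

Definition free_space : tvsType R := free_lmod.

Lemma free_gen_continuous : continuous (free_gen : X -> free_lmod).
Proof.
move=> x A [W dW WA]; have [_ _ /(_ 1 x)] := dW.
apply: filterS => y; rewrite /= scale1r => /WA.
by rewrite addrC subrK.
Qed.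

(** The preimage of a disk neighborhood of [0] under the linear extension of a
    continuous [f] is one of the disks that generate the topology: it absorbs
    because neighborhoods of [0] absorb, and the condition on generators is
    the continuity of [f]. *)
Lemma free_lift_continuous (E : tvsType R) (f : X -> E) :
  continuous f -> continuous (free_lift f).
Proof.
move=> cf v A nA.
have [W [dW WA nW]] : exists W : set E,
    [/\ disk W, W `<=` [set e | A (free_lift f v + e)] & nbhs 0 W].
  apply: tvs_disk; have := nbhsB (- free_lift f v) nA; rewrite addNr.
  by apply: filterS => _ [u Au <-] /=; rewrite addrA subrr add0r.
exists (free_lift f @^-1` W); last first.
  by move=> w /WA; rewrite /= linearD.
split.
- by move=> a b u w ab; rewrite /= linearD !linearZ; exact: dW.
- move=> u; have := @scale_continuous R E (0, free_lift f u).
  move=> /(_ W); rewrite /= scale0r => /(_ nW).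
  move=> [[U V] [/= /nbhs_ballP[e e0 eU] nV] UV].
  exists (e / 2); first by rewrite divr_gt0.
  rewrite /= linearZ; apply: (UV (e / 2, free_lift f u)).
  split=> /=; last exact: nbhs_singleton.
  apply: eU; rewrite /ball /= sub0r normrN gtr0_norm ?divr_gt0//.
  by rewrite ltr_pdivrMr// ltr_pMr// ltr1n.
- move=> e x.
  have c : continuous (fun y => e *: (f y - f x)).
    move=> y; apply: (@continuous_comp _ (R^o * E)%type _
      (fun y => (e, f y - f x)) (fun z => z.1 *: z.2)); last first.
      exact: scale_continuous.
    apply: (@cvg_pair _ _ _ _ (nbhs (e : R^o))); first exact: cvg_cst.
    apply: (@continuous_comp _ (E * E)%type _
      (fun y => (f y, f x)) (fun z => z.1 - z.2)); last first.
      exact: tvs.sub_continuous.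
    by apply: cvg_pair; [exact: cf|exact: cvg_cst].
  have : \forall y \near x, W (e *: (f y - f x)).
    by apply: c; rewrite subrr scaler0.
  apply: filterS => y Wy; rewrite /= linearZ linearB /= !free_lift_gen.
  exact: Wy.
Qed.

End free_space.

(** * Separation and the universal property *)

Definition functionally_hausdorff (R : realType) (X : topologicalType) :=
  forall x y : X, x <> y -> exists2 f : X -> R, continuous f & f x <> f y.

Lemma tychonoff_functionally_hausdorff (R : realType) (X : topologicalType) :
  tychonoff_space X -> functionally_hausdorff R X.
Proof.
move=> [hX crX] x y xy.
have : uniform_separator [set x] [set y].
  apply: crX; last exact: xy.
  exact: accessible_closed_set1 (hausdorff_accessible hX) _.
move=> /(@uniform_separatorP _ R)[f [cf _ fx fy]]; exists f => //.
have -> : f x = 0 by apply: fx; exists x.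
have -> : f y = 1 by apply: fy; exists y.
by apply/eqP; rewrite eq_sym oner_neq0.
Qed.

Lemma set_functionally_hausdorff (R : realType) (X : topologicalType)
    (K : set X) :
  functionally_hausdorff R X -> functionally_hausdorff R K.
Proof.
move=> fhX x y xy; have [f cf fxy] := fhX _ _ (contra_not (@val_inj _ _ _ x y) xy).
exists (f \o set_val) => // z.
apply: continuous_comp; first exact: initial_continuous.
exact: cf.
Qed.

Lemma functionally_hausdorff_hausdorff (R : realType) (X : topologicalType) :
  functionally_hausdorff R X -> hausdorff_space X.
Proof.
move=> fhX x y xy; apply: contrapT => /fhX[f cf]; apply.
apply: (@Rhausdorff R) => A B fA fB.
have [z [Az Bz]] := xy _ _ (cf x A fA) (cf y B fB).
by exists (f z).
Qed.

(** The product of the functions [g - g z], where [g] separates [x] from the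
    entry [z]. *)
Lemma functionally_hausdorff_bump (R : realType) (X : topologicalType)
    (x : X) (s : seq X) : functionally_hausdorff R X -> x \notin s ->
  exists f : X -> R,
    [/\ continuous f, f x != 0 & forall y, y \in s -> f y = 0].
Proof.
move=> fhX; elim: s => [_|z s IHs].
  exists (cst 1); split; rewrite ?oner_eq0//.
  by move=> y; exact: cvg_cst.
rewrite in_cons negb_or => /andP[/eqP xz /IHs[f [cf fx fs]]].
have [g cg gxz] := fhX _ _ xz.
exists (fun y => f y * (g y - g z)); split.
- move=> y; apply: cvgM; first exact: cf.
  by apply: cvgB; [exact: cg|exact: cvg_cst].
- by rewrite mulf_neq0// subr_eq0; exact/eqP.
- move=> y; rewrite in_cons => /predU1P[->|/fs ->]; last by rewrite mul0r.
  by rewrite subrr mulr0.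
Qed.

(** To separate two vectors [v] and [w] that differ in the coefficient of some
    [x], take a real function vanishing on their supports except at [x]: its
    linear extension reads off that coefficient, up to a nonzero factor. *)
Theorem is_free_free_space (R : realType) (X : topologicalType) :
  functionally_hausdorff R X ->
  @is_free_lcs R X (free_space R X) (@free_gen R X).
Proof.
move=> fhX; have sep : functionally_hausdorff R (free_space R X).
  move=> v w vw.
  have [x vwx] : exists x, coeff x v <> coeff x w.
    apply: contrapT => /forallNP vwE; apply: vw.
    by apply/eqP/freeg_eqP => x; apply: contrapT; exact: vwE.
  have [|f [cf fx f0]] := functionally_hausdorff_bump (x := x)
    (s := rem x (undup (dom v ++ dom w))) fhX.
    by rewrite mem_rem_uniq ?undup_uniq// inE eqxx.
  have liftE u : {subset dom u <= dom v ++ dom w} ->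
      free_lift (f : X -> R^o) u = coeff x u * f x.
    move=> uvw; rewrite {1}[u]free_genE linear_sum /=.
    rewrite (bigID (pred1 x)) /= [X in _ + X]big_seq_cond.
    rewrite [X in _ + X]big1 ?addr0 => [|y /andP[yu yx]]; last first.
      rewrite linearZ /= free_lift_gen f0 ?scaler0//.
      by rewrite mem_rem_uniq ?undup_uniq// inE yx mem_undup uvw.
    have [xu|xu] := boolP (x \in dom u); last first.
      rewrite coeff_outdom// mul0r big_seq_cond big1// => y /andP[yu /eqP yx].
      by move: xu; rewrite -yx yu.
    rewrite -big_filter filter_pred1_uniq ?uniq_dom// big_seq1.
    by rewrite linearZ /= free_lift_gen.
  exists (free_lift (f : X -> R^o)); first exact: free_lift_continuous.
  rewrite !liftE; last 2 first.
  - by move=> y; rewrite mem_cat => ->; rewrite orbT.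
  - by move=> y; rewrite mem_cat => ->.
  by move/(mulIf fx).
split.
- exact: functionally_hausdorff_hausdorff sep.
- exact: free_gen_continuous.
- move=> x y xy; apply: contrapT => yx.
  have := congr1 (coeff x) xy; rewrite !coeffU !mul1r eqxx.
  have /eqP/negbTE -> : y <> x by move=> E; apply: yx.
  by move/eqP; rewrite oner_eq0.
- move=> v; exists [seq (coeff x v, x) | x <- dom v].
  by rewrite big_map; exact: free_genE.
- move=> E f _ cf; exists (free_lift f); split.
    exact: free_lift_continuous.
  by apply/funext => x /=; rewrite free_lift_gen.
Qed.

(** * Retractions onto the same subspace are L-equivalent *)

Lemma free_lcs_ext (R : realType) (X : topologicalType) (L : tvsType R)
    (d : X -> L) (E : lmodType R) (h k : {linear L -> E}) :
  is_free_lcs d -> (forall x, h (d x) = k (d x)) -> h =1 k.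
Proof.
move=> [_ _ _ spanL _] hk v; have [s ->] := spanL v.
by rewrite !linear_sum; apply: eq_bigr => p _; rewrite !linearZ /= hk.
Qed.

Lemma tvs_continuousD (R : realType) (X : topologicalType) (E : tvsType R)
    (f g : X -> E) : continuous f -> continuous g ->
  continuous (fun x => f x + g x).
Proof.
move=> cf cg x; apply: (@continuous_comp _ (E * E)%type _
  (fun y => (f y, g y)) (fun z => z.1 + z.2)); last exact: tvs.add_continuous.
by apply: cvg_pair; [exact: cf|exact: cg].
Qed.

Lemma tvs_continuousB (R : realType) (X : topologicalType) (E : tvsType R)
    (f g : X -> E) : continuous f -> continuous g ->
  continuous (fun x => f x - g x).
Proof.
move=> cf cg x; apply: (@continuous_comp _ (E * E)%type _
  (fun y => (f y, g y)) (fun z => z.1 - z.2)); last exact: tvs.sub_continuous.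
by apply: cvg_pair; [exact: cf|exact: cg].
Qed.

(** The endomorphism that exchanges the roles of [f_#] and [g_#], obtained from
    the universal property applied to a map of [X] into [L(X)]. *)
Lemma free_swap (R : realType) (X : topologicalType) (K : set X)
    (L : tvsType R) (d : X -> L) (f g : X -> K) :
  is_free_lcs d -> continuous f -> continuous g ->
  exists2 h : {linear L -> L}, continuous h &
    forall x, h (d x) = d x + d (set_val (f x)) - d (set_val (g x)).
Proof.
move=> [lcsL cd _ _ univ] cf cg.
have cval (r : X -> K) : continuous r -> continuous (d \o set_val \o r).
  move=> cr x; apply: continuous_comp; first exact: cr.
  apply: continuous_comp; first exact: initial_continuous.
  exact: cd.
have [|h [ch hE]] :=
  univ L (fun x => d x + d (set_val (f x)) - d (set_val (g x))) lcsL.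
  apply: tvs_continuousB; last exact: cval.
  by apply: tvs_continuousD; last exact: cval.
by exists h => // x; rewrite -[LHS]/((h \o d) x) -hE.
Qed.

(** The swaps for [(f, g)] and for [(g, f)] are mutually inverse: [f] and [g]
    fix each other's values, so [d (f x)] and [d (g x)] are fixed by [k], and
    the correction terms cancel. *)
Lemma free_swapK (R : realType) (X : topologicalType) (K : set X)
    (L : tvsType R) (d : X -> L) (f g : X -> K) (h k : {linear L -> L}) :
  is_free_lcs d -> retraction f -> retraction g ->
  (forall x, h (d x) = d x + d (set_val (f x)) - d (set_val (g x))) ->
  (forall x, k (d x) = d x + d (set_val (g x)) - d (set_val (f x))) ->
  cancel h k.
Proof.
move=> dL [_ fK] [_ gK] hE kE.
apply: (free_lcs_ext (h := k \o h) (k := idfun) dL) => x /=.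
by rewrite hE linearB linearD !kE !fK !gK !addrK subrK addrK.
Qed.

(** The free space on [X] serves for both maps; on the free space on [K] the
    isomorphism is the identity. *)
Theorem retraction_L_equivalent (R : realType) (X : topologicalType)
    (K : set X) (f g : X -> K) :
  functionally_hausdorff R X -> retraction f -> retraction g ->
  L_equivalent R f g.
Proof.
move=> fhX rf rg; have [[cf fK] [cg gK]] := (rf, rg).
have dX := is_free_free_space fhX.
have dK := is_free_free_space (set_functionally_hausdorff (K := K) fhX).
have [_ cdK _ _ _] := dK.
have [lcsK _ _ _ _] := dK.
have sharp (r : X -> K) : continuous r -> exists h, is_sharp
    (@free_gen R X : X -> free_space R X)
    (@free_gen R K : K -> free_space R K) r h.
  move=> cr; have [_ _ _ _ univ] := dX.
  have [|h [ch hE]] := univ (free_space R K) (@free_gen R K \o r) lcsK.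
    by move=> x; apply: continuous_comp; [exact: cr|exact: cdK].
  by exists h.
have [fs fsE] := sharp f cf; have [gs gsE] := sharp g cg.
have [phi cphi phiE] := free_swap dX cf cg.
have [phi' cphi' phiE'] := free_swap dX cg cf.
split => //; exists (free_space R X), (free_space R K), (free_space R X),
  (free_space R K), (@free_gen R X), (@free_gen R K), (@free_gen R X),
  (@free_gen R K); split => //.
exists fs, gs, phi, idfun; split => //.
- split => //; exists phi'; split => //.
    exact: free_swapK dX rf rg phiE phiE'.
  exact: free_swapK dX rg rf phiE' phiE.
- have cid : continuous (idfun : free_space R K -> free_space R K).
    by move=> v; exact: cvg_id.
  by split => //; exists idfun.
- have fsd x : fs (free_gen R x) = free_gen R (f x).
    by case: fsE => _ /(congr1 (@^~ x)).
  have gsd x : gs (free_gen R x) = free_gen R (g x).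
    by case: gsE => _ /(congr1 (@^~ x)).
  apply/funext.
  apply: (free_lcs_ext (h := fs) (k := gs \o phi) dX) => x /=.
  by rewrite phiE linearB linearD !gsd fsd !gK addrAC addrN add0r.
Qed.

(** * Two copies of a compact space without isolated points *)

Lemma set_hausdorff (X : topologicalType) (K : set X) :
  hausdorff_space X -> hausdorff_space K.
Proof.
move=> hX x y xy; apply: val_inj; apply: hX => A B xA yB.
have [z [Az Bz]] := xy _ _ (@initial_continuous _ _ set_val x A xA)
  (@initial_continuous _ _ set_val y B yB).
by exists (set_val z).
Qed.

Lemma prod_hausdorff (X Y : topologicalType) :
  hausdorff_space X -> hausdorff_space Y -> hausdorff_space (X * Y)%type.
Proof.
move=> hX hY [x y] [x' y'] xy; congr pair.
  apply: hX => A B xA x'B.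
  have [] := xy (A `*` setT) (B `*` setT).
  - by exists (A, setT) => //; split => //; exact: filterT.
  - by exists (B, setT) => //; split => //; exact: filterT.
  - by move=> z [[/= Az _] [/= Bz _]]; exists z.1.
apply: hY => A B yA y'B.
have [] := xy (setT `*` A) (setT `*` B).
- by exists (setT, A) => //; split => //; exact: filterT.
- by exists (setT, B) => //; split => //; exact: filterT.
- by move=> z [[/= _ Az] [/= _ Bz]]; exists z.2.
Qed.

Lemma compact_perfect_mapping (X Y : topologicalType) (f : X -> Y) :
  compact [set: X] -> hausdorff_space Y -> continuous f -> perfect_mapping f.
Proof.
move=> cX hY cf; have closedK (C : set X) : closed C -> compact C.
  by move=> clC; exact: subclosed_compact clC cX _.
split => // [C clC|y].
  apply: compact_closed => //; apply: continuous_compact; last exact: closedK.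
  exact: continuous_subspaceT.
apply: closedK; apply: closed_comp => [x _|]; first exact: cf.
exact: accessible_closed_set1 (hausdorff_accessible hY) _.
Qed.

Section two_copies.
Context (Y : topologicalType) (y0 : Y).

Definition sheet : set (bool * Y) := [set p | p.1 = false].

Definition to_sheet (y : Y) : sheet := exist _ (false, y) (mem_set erefl).

Definition fold (p : bool * Y) : sheet := to_sheet p.2.

Definition collapse (p : bool * Y) : sheet :=
  to_sheet (if p.1 then y0 else p.2).

Lemma to_sheet_continuous : continuous to_sheet.
Proof.
apply: (@continuous_comp_initial sheet Y (bool * Y)%type set_val).
have -> : set_val \o to_sheet = fun y => (false, y) by [].
by move=> y; apply: (@cvg_pair _ _ _ _ (nbhs false) (nbhs y));
  [exact: cvg_cst|exact: cvg_id].
Qed.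

Lemma to_sheetK (p : sheet) : to_sheet (set_val p).2 = p.
Proof.
apply: val_inj; case: p => -[b y] /= pE.
by have := set_mem pE; rewrite /sheet /= => ->.
Qed.

Lemma fold_retraction : retraction fold.
Proof.
split; last by move=> p; exact: to_sheetK.
move=> p; apply: continuous_comp; first exact: cvg_snd.
exact: to_sheet_continuous.
Qed.

Lemma collapse_retraction : retraction collapse.
Proof.
split; last first.
  move=> p; rewrite -[RHS]to_sheetK /collapse.
  by have := set_valP p; rewrite /sheet /= => ->.
move=> [b y]; apply: (@continuous_comp _ _ _
  (fun p : bool * Y => if p.1 then y0 else p.2) to_sheet); last first.
  exact: to_sheet_continuous.
(* each copy is open, so continuity can be checked on each separately *)
move=> A /= nA; exists ([set b], [set z | A (if b then y0 else z)]) => /=.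
  split; first by apply: open_nbhs_nbhs; split; [exact: discrete_open|].
  by case: b nA => // /nbhs_singleton Ay0; exact: nearW.
by move=> [_ z] [/= -> Az].
Qed.

(** The image of [U] is the trace on the first copy of the union of the two
    slices of [U]. *)
Lemma fold_open : open_mapping fold.
Proof.
move=> U oU.
have oUb b : open [set p : bool * Y | U (b, p.2)].
  apply: open_comp => // p _.
  by apply: (@cvg_pair _ _ _ _ (nbhs b) (nbhs p.2));
    [exact: cvg_cst|exact: cvg_snd].
exists ([set p | U (true, p.2)] `|` [set p | U (false, p.2)]).
  exact: openU.
apply/seteqP; split => [p /=|_ [[b y] Uby <-] /=].
  by case=> Up; [exists (true, (set_val p).2)|exists (false, (set_val p).2)];
    rewrite // /fold to_sheetK.
by case: b Uby; [left|right].
Qed.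

(** The second copy is open and its image is the point [y0]. *)
Lemma collapse_not_open : ~ open [set y0] -> ~ open_mapping collapse.
Proof.
move=> ny0 oc; apply: ny0.
pose U := [set p : bool * Y | p.1 = true].
have oU : open U.
  apply: (@open_comp _ _ fst [set true]); last exact: discrete_open.
  by move=> p _; exact: cvg_fst.
suff -> : [set y0] = to_sheet @^-1` (collapse @` U).
  apply: open_comp => [y _|]; last exact: oc.
  exact: to_sheet_continuous.
apply/seteqP; split => [_ -> /=|y [[b z] + /(congr1 (snd \o val)) /=]].
  by exists (true, y0).
by rewrite /U /= => -> <-.
Qed.

End two_copies.
Arguments sheet Y : clear implicits.

Theorem corollary4p14 (R : realType) :
  exists (X Z : topologicalType) (Y : set X) (T : set Z)
    (f : X -> Y) (g : Z -> T),
    [/\ tychonoff_space X /\ tychonoff_space Z,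
        retraction f /\ perfect_mapping f,
        retraction g /\ perfect_mapping g,
        L_equivalent R f g &
        open_mapping f /\ ~ open_mapping g].
Proof.
have compX : compact [set: bool * cantor_space].
  rewrite -setXTT; apply: compact_setX; first exact: bool_compact.
  exact: cantor_space_compact.
have hX : hausdorff_space (bool * cantor_space)%type.
  by apply: prod_hausdorff; [exact: discrete_hausdorff|exact: cantor_space_hausdorff].
have tX : tychonoff_space (bool * cantor_space)%type.
  by split => //; exact: uniform_completely_regular.
pose y0 : cantor_space := point.
have rf := fold_retraction cantor_space.
have rg := collapse_retraction y0.
have hS : hausdorff_space (sheet cantor_space) by exact: set_hausdorff.
exists (bool * cantor_space)%type, (bool * cantor_space)%type,
  (sheet cantor_space), (sheet cantor_space), (@fold cantor_space),
  (collapse y0).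
split => //.
- by split=> //; apply: compact_perfect_mapping => //; case: rf.
- by split=> //; apply: compact_perfect_mapping => //; case: rg.
- apply: retraction_L_equivalent => //.
  exact: tychonoff_functionally_hausdorff.
- split; first exact: fold_open.
  by apply: collapse_not_open; exact: (perfectTP.1 cantor_perfect).
Qed.
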